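(* Let $P=P_{(a,b)}\in\mathcal X_3(\overline{\mathbb F}_{q^2})\setminus\mathcal O$ with $\alpha(P)^2-\alpha(P)+1\neq0$, and let $i$ be the $\mathcal P$-order of $\alpha(P)$. If $i\le m-2$, then there exists a function $f_i\in L((3i+3)D_\infty)$ with $v_P(f_i)=3i+3$. Moreover, for each integer $j$ with $0\le j\le\min\{i-1,m-2\}$ there exists a function $f_j\in L((3j+3)D_\infty)$ with $v_P(f_j)=3j+2$.
   Context: Let $q$ be a prime power with $q\equiv2\pmod3$, $m=(q+1)/3$, and let $\mathcal X_3$ be the nonsingular projective model (defined over $\mathbb F_{q^2}$) of the plane curve $y^{q+1}+x^{2m}+x^m=0$. Let $\mathcal O_0$ be the $m$ points centered at the singular point $(0,0)$ (zeros of $x$) and $\mathcal O_\infty=\{P_\infty^1,\dots,P_\infty^m\}$ the $m$ points over the point at infinity (poles of $x$); $D_\infty=\sum_{j=1}^mP_\infty^j$ and $L(D)$ is the Riemann–Roch space of $D$. Other points have affine coordinates $(a,b)$, $a\ne0$, and are denoted $P_{(a,b)}$. Let $\mathcal O_m=\{P_{(a,0)}:a^m+1=0\}$, $\mathcal O=\mathcal O_0\cup\mathcal O_\infty\cup\mathcal O_m$, and for $P=P_{(a,b)}\notin\mathcal O$ let $\alpha(P)=a^m/(1+a^m)$. Fix a primitive cube root of unity $\zeta_3\in\mathbb F_{q^2}$, let $\mathcal P_i(s)=\frac{(s+\zeta_3)^{3i}-(s+\zeta_3^2)^{3i}}{3(\zeta_3-\zeta_3^2)s(s-1)}$, and for $\alpha\in\overline{\mathbb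 F}_{q^2}\setminus\{0,1,-\zeta_3,-\zeta_3^2\}$ let the $\mathcal P$-order of $\alpha$ be the smallest positive integer $i$ with $\mathcal P_{i+1}(\alpha)=0$. $v_P$ is the valuation at $P$. *)

(* Defs.v *)
From HB Require Import structures.
From mathcomp Require Import all_boot all_order all_algebra.
Set Implicit Arguments. Unset Strict Implicit. Unset Printing Implicit Defensive.
Import Order.TTheory GRing.Theory Num.Theory.
Local Open Scope ring_scope.

Definition ev2 (K F : fieldType) (iota : K -> F) (x y : F)
    (P : {poly {poly K}}) : F :=
  (map_poly (fun c : {poly K} => (map_poly iota c).[x]) P).[y].

Definition curve_poly (K : fieldType) (q m : nat) : {poly {poly K}} :=
  'X^(q.+1) + ('X^(2 * m) + 'X^m)%:P.

(* F (with the embedding iota of the constant field K) is the function field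
   K(x,y) of the curve: F is generated as a field by K, x, y and the kernel of
   K[X,Y] -> F, (X,Y) |-> (x,y) is exactly the ideal (curve_poly). *)
Definition is_curve_function_field (K F : fieldType) (iota : K -> F)
    (q m : nat) (x y : F) : Prop :=
  [/\ ev2 iota x y (curve_poly K q m) = 0,
      (forall P : {poly {poly K}}, ev2 iota x y P = 0 ->
          exists R, P = curve_poly K q m * R)
    & (forall f : F, exists P Q : {poly {poly K}},
          ev2 iota x y Q != 0 /\ f = ev2 iota x y P / ev2 iota x y Q)].

(* A place of F/K, given by its normalized discrete valuation
   (values on nonzero elements; v 0 stands for +infinity and is irrelevant). *)
Definition is_place (K F : fieldType) (iota : K -> F) (v : F -> int) : Prop :=
  [/\ (forall f g : F, f != 0 -> g != 0 -> v (f * g) = v f + v g),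
      (forall f g : F, f != 0 -> g != 0 -> f + g != 0 ->
          Num.min (v f) (v g) <= v (f + g)),
      (forall c : K, c != 0 -> v (iota c) = 0)
    & (exists t : F, t != 0 /\ v t = 1)].

(* Membership in the Riemann-Roch space L(k D_infty), where D_infty is the sum
   (each with multiplicity one) of the places that are poles of x. *)
Definition in_L_Dinf (K F : fieldType) (iota : K -> F) (x : F) (k : nat)
    (f : F) : Prop :=
  f = 0 \/ forall w : F -> int, is_place iota w ->
              (if w x < 0 then - (k%:Z) else 0) <= w f.

Definition alphaP (K : fieldType) (m : nat) (a : K) : K :=
  a ^+ m / (1 + a ^+ m).

Definition Pval (K : fieldType) (z : K) (i : nat) (s : K) : K :=
  ((s + z) ^+ (3 * i) - (s + z ^+ 2) ^+ (3 * i)) /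
  (3%:R * (z - z ^+ 2) * s * (s - 1)).

Definition is_Porder (K : fieldType) (z : K) (al : K) (i : nat) : Prop :=
  [/\ (0 < i)%N, Pval z i.+1 al = 0
    & forall k : nat, (0 < k)%N -> (k < i)%N -> Pval z k.+1 al != 0].

(* Main.v *)
(** Put [T = x^m] and let [z] be a primitive cube root of unity.  Since
    [q + 1 = 3m], Frobenius gives [T^3 = x * x^q] and [T^2 + T = - y * y^q], so
    at [P] these agree up to order [q] with [a^q x] and [- b^q y], which lie in
    [L(3 D_infty)].  The span of [1], [T^3] and [T^2 + T] is the linear system
    of a plane nodal cubic parametrized by [T], with node at [T = z, z^2]; in
    terms of [l1 = T - z] and [l2 = z^2 - T] it is spanned by [l1^3 + l2^3],
    [l1^2 l2] and [l1 l2^2].  Hence every binary form of degree [3k] in [l1],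
    [l2] whose coefficients at [l1^(3k)] and [l2^(3k)] agree lifts, modulo order
    [q], to [L(3k D_infty)].  With [A = a^m] and [t = T - A], a uniformizer at
    [P], some [t^(3k-1) (c l1 + d l2)] is always such a form, and [t^(3k)] is one
    exactly when [(A - z^2)^(3k) = (A - z)^(3k)], that is, when
    [P_k(alpha(P)) = 0]. *)
Require Import Defs.
From HB Require Import structures.
From mathcomp Require Import all_boot all_order all_algebra.
From mathcomp Require Import ring zify.
Set Implicit Arguments. Unset Strict Implicit. Unset Printing Implicit Defensive.
Import Order.TTheory GRing.Theory Num.Theory.
Local Open Scope ring_scope.

(** * Calculus of valuation ideals at a place *)

(* [v 0] is a junk value, so [0] is put in every valuation ideal by hand. *)
Definition val_ge (F : fieldType) (v : F -> int) (n : int) (f : F) : Prop :=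
  f = 0 \/ n <= v f.

Definition val_eq (F : fieldType) (v : F -> int) (n : int) (f : F) : Prop :=
  f != 0 /\ v f = n.

Lemma val_geW (F : fieldType) (v : F -> int) n n' f :
  n' <= n -> val_ge v n f -> val_ge v n' f.
Proof. by move=> le [->|h]; [left | right; apply: le_trans h]. Qed.

Lemma val_eq_ge (F : fieldType) (v : F -> int) n f : val_eq v n f -> val_ge v n f.
Proof. by move=> [_ <-]; right. Qed.

Lemma val_ge_le (F : fieldType) (v : F -> int) n f :
  val_ge v n f -> f != 0 -> n <= v f.
Proof. by move=> [->|//]; rewrite eqxx. Qed.

Lemma val_eqM (K F : fieldType) (iota : {rmorphism K -> F}) v n n' f g :
  is_place iota v -> val_eq v n f -> val_eq v n' g -> val_eq v (n + n') (f * g).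
Proof.
by move=> [vM _ _ _] [f0 <-] [g0 <-]; split; rewrite ?mulf_neq0 // vM.
Qed.

Lemma val_geM (K F : fieldType) (iota : {rmorphism K -> F}) v n n' f g :
  is_place iota v -> val_ge v n f -> val_ge v n' g -> val_ge v (n + n') (f * g).
Proof.
move=> [vM _ _ _] hf hg.
have [->|f0] := eqVneq f 0; first by rewrite mul0r; left.
have [->|g0] := eqVneq g 0; first by rewrite mulr0; left.
by right; rewrite vM // lerD // val_ge_le.
Qed.

Lemma val_geD (K F : fieldType) (iota : {rmorphism K -> F}) v n f g :
  is_place iota v -> val_ge v n f -> val_ge v n g -> val_ge v n (f + g).
Proof.
move=> [_ vD _ _] hf hg.
have [->|f0] := eqVneq f 0; first by rewrite add0r.
have [->|g0] := eqVneq g 0; first by rewrite addr0.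
have [->|s0] := eqVneq (f + g) 0; first by left.
by right; apply: le_trans (vD _ _ f0 g0 s0); rewrite le_min !val_ge_le.
Qed.

Lemma val_eq_const (K F : fieldType) (iota : {rmorphism K -> F}) v c :
  is_place iota v -> c != 0 -> val_eq v 0 (iota c).
Proof. by move=> [_ _ vK _] c0; split; rewrite ?fmorph_eq0 ?vK. Qed.

Lemma val_ge_const (K F : fieldType) (iota : {rmorphism K -> F}) v c :
  is_place iota v -> val_ge v 0 (iota c).
Proof.
move=> Hv; have [->|c0] := eqVneq c 0; first by rewrite rmorph0; left.
by apply: val_eq_ge; apply: val_eq_const.
Qed.

Lemma val_ge1 (K F : fieldType) (iota : {rmorphism K -> F}) v :
  is_place iota v -> val_ge v 0 1.
Proof. by move=> Hv; rewrite -(rmorph1 iota); apply: val_ge_const. Qed.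

Lemma val_geZ (K F : fieldType) (iota : {rmorphism K -> F}) v n c f :
  is_place iota v -> val_ge v n f -> val_ge v n (iota c * f).
Proof. by move=> Hv h; rewrite -[n]add0r; apply: (val_geM Hv) h; apply: val_ge_const. Qed.

Lemma val_geN (K F : fieldType) (iota : {rmorphism K -> F}) v n f :
  is_place iota v -> val_ge v n f -> val_ge v n (- f).
Proof.
move=> Hv h; have -> : - f = iota (-1) * f by ring.
exact: (val_geZ _ Hv).
Qed.

Lemma val_geB (K F : fieldType) (iota : {rmorphism K -> F}) v n f g :
  is_place iota v -> val_ge v n f -> val_ge v n g -> val_ge v n (f - g).
Proof. by move=> Hv hf hg; apply: (val_geD Hv) => //; apply: val_geN Hv _. Qed.

Lemma val_geX (K F : fieldType) (iota : {rmorphism K -> F}) v (n k : nat) f :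
  is_place iota v -> val_ge v n%:Z f -> val_ge v (k * n)%:Z (f ^+ k).
Proof.
move=> Hv h; elim: k => [|k IH]; first by rewrite expr0; apply: val_ge1 Hv.
by rewrite exprS mulSn PoszD; apply: (val_geM Hv).
Qed.

Lemma val_eqX (K F : fieldType) (iota : {rmorphism K -> F}) v n (k : nat) f :
  is_place iota v -> val_eq v n f -> val_eq v (k%:Z * n) (f ^+ k).
Proof.
move=> Hv h; elim: k => [|k IH].
  by rewrite expr0 mul0r -(rmorph1 iota); apply: val_eq_const => //; apply: oner_neq0.
by rewrite exprS intS mulrDl mul1r; apply: (val_eqM Hv).
Qed.

(** If [g] had valuation above [n], then so would [f = g - (g - f)]. *)
Lemma val_eq_near (K F : fieldType) (iota : {rmorphism K -> F}) v n f g :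
  is_place iota v -> val_eq v n f -> val_ge v (n + 1) (g - f) -> val_eq v n g.
Proof.
move=> Hv [f0 vf] h.
have ge1 : ~ val_ge v (n + 1) g.
  move=> hg; have : val_ge v (n + 1) f.
    by rewrite -[f](subKr g); apply: (val_geB Hv).
  by move/val_ge_le/(_ f0); rewrite vf; lia.
have g0 : g != 0 by apply/eqP => g0; apply: ge1; rewrite g0; left.
split=> //; have : val_ge v n g.
  rewrite -[g](subrK f); apply: (val_geD Hv) => //; last by right; rewrite vf.
  by apply: val_geW h; lia.
move/val_ge_le/(_ g0) => le; apply/eqP; rewrite eq_le le andbT.
rewrite leNgt; apply/negP => lt; apply: ge1; right; lia.
Qed.

Lemma val_eq_unit (K F : fieldType) (iota : {rmorphism K -> F}) v c f :
  is_place iota v -> c != 0 -> val_ge v 1 (f - iota c) -> val_eq v 0 f.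
Proof. by move=> Hv c0 h; apply: (val_eq_near Hv) (val_eq_const Hv c0) _; rewrite add0r. Qed.

Lemma val_ge_residue (K F : fieldType) (iota : {rmorphism K -> F}) v c f :
  is_place iota v -> val_ge v 1 (f - iota c) -> val_ge v 0 f.
Proof.
move=> Hv h; rewrite -[f](subrK (iota c)); apply: (val_geD Hv) => //.
  by apply: val_geW h.
exact: (val_ge_const _ Hv).
Qed.

(** * Rings generated by two functions, and local parameters *)

(** The ring [K[s, t]] inside [F], as an inductive predicate so that its elements are handled by
    induction instead of through bivariate polynomials. *)
Inductive gen_alg (K F : fieldType) (iota : K -> F) (s t : F) : F -> Prop :=
| gen_const c : gen_alg iota s t (iota c)
| gen_fst : gen_alg iota s t s
| gen_snd : gen_alg iota s t t
| gen_add f g : gen_alg iota s t f -> gen_alg iota s t g ->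
    gen_alg iota s t (f + g)
| gen_mul f g : gen_alg iota s t f -> gen_alg iota s t g ->
    gen_alg iota s t (f * g).

Definition gen_frac (K F : fieldType) (iota : K -> F) (s t f : F) : Prop :=
  exists r1 r2, [/\ gen_alg iota s t r1, gen_alg iota s t r2, r2 != 0
    & f = r1 / r2].

Lemma gen_algX (K F : fieldType) (iota : {rmorphism K -> F}) s t f n :
  gen_alg iota s t f -> gen_alg iota s t (f ^+ n).
Proof.
move=> h; elim: n => [|n IH]; last by rewrite exprS; apply: gen_mul.
by rewrite expr0 -(rmorph1 iota); apply: gen_const.
Qed.

Lemma gen_alg_frac (K F : fieldType) (iota : {rmorphism K -> F}) s t f :
  gen_alg iota s t f -> gen_frac iota s t f.
Proof.
exists f, (iota 1); split=> //; first exact: gen_const.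
  by rewrite rmorph1 oner_neq0.
by rewrite rmorph1 divr1.
Qed.

Lemma gen_fracD (K F : fieldType) (iota : {rmorphism K -> F}) s t f g :
  gen_frac iota s t f -> gen_frac iota s t g -> gen_frac iota s t (f + g).
Proof.
move=> [r1 [r2 [h1 h2 h20 ->]]] [r3 [r4 [h3 h4 h40 ->]]].
exists (r1 * r4 + r3 * r2), (r2 * r4); split; rewrite ?mulf_neq0 ?addf_div //.
  by apply: gen_add; apply: gen_mul.
exact: gen_mul.
Qed.

Lemma gen_fracM (K F : fieldType) (iota : {rmorphism K -> F}) s t f g :
  gen_frac iota s t f -> gen_frac iota s t g -> gen_frac iota s t (f * g).
Proof.
move=> [r1 [r2 [h1 h2 h20 ->]]] [r3 [r4 [h3 h4 h40 ->]]].
exists (r1 * r3), (r2 * r4); split; rewrite ?mulf_neq0 ?mulf_div //;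
  exact: gen_mul.
Qed.

Lemma gen_fracV (K F : fieldType) (iota : {rmorphism K -> F}) s t f :
  gen_frac iota s t f -> gen_frac iota s t f^-1.
Proof.
move=> [r1 [r2 [h1 h2 h20 ->]]].
have [r10|r10] := eqVneq r1 0.
  rewrite r10 mul0r invr0 -(rmorph0 iota); apply: gen_alg_frac; exact: gen_const.
by exists r2, r1; split; rewrite ?invf_div.
Qed.

Lemma gen_frac_alg (K F : fieldType) (iota : {rmorphism K -> F}) s t x y f :
  gen_frac iota s t x -> gen_frac iota s t y ->
  gen_alg iota x y f -> gen_frac iota s t f.
Proof.
move=> hx hy; elim=> [c|||f1 g1 _ h1 _ h2|f1 g1 _ h1 _ h2] //.
- by apply: gen_alg_frac; apply: gen_const.
- exact: gen_fracD.
- exact: gen_fracM.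
Qed.

(** [K[s, t]] modulo the ideal of the point [(s0, t0)] is [K]: in a product the constants multiply,
    and every other term keeps a factor [s - s0] or [t - t0]. *)
Lemma gen_alg_res (K F : fieldType) (iota : {rmorphism K -> F}) s t s0 t0 f :
  gen_alg iota s t f -> exists c r1 r2,
    [/\ gen_alg iota s t r1, gen_alg iota s t r2
      & f = iota c + (s - iota s0) * r1 + (t - iota t0) * r2].
Proof.
elim=> [c|||f1 g1 hf [c [r1 [r2 [h1 h2 e]]]] hg [c' [r1' [r2' [h1' h2' e']]]]
  |f1 g1 hf [c [r1 [r2 [h1 h2 e]]]] hg [c' [r1' [r2' [h1' h2' e']]]]].
- exists c, (iota 0), (iota 0); split; try exact: gen_const; ring.
- exists s0, (iota 1), (iota 0); split; try exact: gen_const; ring.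
- exists t0, (iota 0), (iota 1); split; try exact: gen_const; ring.
- exists (c + c'), (r1 + r1'), (r2 + r2'); split; try exact: gen_add.
  by rewrite e e'; ring.
- exists (c * c'), (r1 * g1 + iota c * r1'), (r2 * g1 + iota c * r2').
  split; try by apply: gen_add; apply: gen_mul => //; apply: gen_const.
  by rewrite {1}e mulrDl mulrDl {1}e'; ring.
Qed.

Lemma gen_alg_val_ge0 (K F : fieldType) (iota : {rmorphism K -> F}) s t v f :
  is_place iota v -> val_ge v 0 s -> val_ge v 0 t ->
  gen_alg iota s t f -> val_ge v 0 f.
Proof.
move=> Hv hs ht; elim=> [c|||f1 g1 _ h1 _ h2|f1 g1 _ h1 _ h2] //.
- exact: (val_ge_const _ Hv).
- exact: (val_geD Hv).
- by rewrite -[0]addr0; apply: (val_geM Hv).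
Qed.

(* At a nonsingular point every element of the local ring vanishing at the
   point is divisible by [t - t0], so all valuations are multiples of
   [v (t - t0)]. *)
Lemma val_local_param (K F : fieldType) (iota : {rmorphism K -> F})
    s t s0 t0 v h g :
  is_place iota v -> (forall f, gen_frac iota s t f) ->
  val_ge v 1 (s - iota s0) -> val_ge v 1 (t - iota t0) -> t != iota t0 ->
  gen_alg iota s t h -> gen_alg iota s t g -> val_eq v 0 h ->
  (s - iota s0) * h = (t - iota t0) * g ->
  v (t - iota t0) = 1.
Proof.
move=> Hv frac hs ht; rewrite -subr_eq0 => t0' hh hg [h0 vh] e.
have n1 : 1 <= v (t - iota t0) by apply: val_ge_le t0'.
move en : (v _) n1 => n n1.
have pos f : gen_alg iota s t f -> f != 0 -> 0 <= v f.
  move=> hf; apply: val_ge_le; apply: (gen_alg_val_ge0 Hv _ _ hf).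
    exact: val_ge_residue Hv hs.
  exact: val_ge_residue Hv ht.
have vM : forall f g : F, f != 0 -> g != 0 -> v (f * g) = v f + v g by case: Hv.
(* Induction on a bound [N] for [v f]: each division by [t - t0] lowers the valuation by [n], until
   a unit is reached. *)
have mult N : forall f, gen_alg iota s t f -> f != 0 -> v f <= N%:Z ->
    exists k : int, v f = n * k.
  elim: N => [|N IH] f hf f0 vf.
    by exists 0; move: (pos f hf f0); lia.
  have [c [r1 [r2 [h1 h2 ef]]]] := gen_alg_res s0 t0 hf.
  have [c0|c0] := eqVneq c 0; last first.
    exists 0; have [_ ->] : val_eq v 0 f; last by rewrite mulr0.
    apply: (val_eq_unit Hv c0) => //.
    have -> : f - iota c = (s - iota s0) * r1 + (t - iota t0) * r2.
      by rewrite ef; ring.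
    have ge0 r : gen_alg iota s t r -> val_ge v 0 r.
      by move=> hr; have [->|r0] := eqVneq r 0; [left | right; apply: pos].
    by apply: (val_geD Hv) => //; rewrite -[1]addr0; apply: (val_geM Hv) => //; apply: ge0.
  (* Multiplying [f] by [h], of valuation 0, trades [(s - s0) * h] for [(t - t0) * g], so that
     [t - t0] divides [f * h]. *)
  pose f' := g * r1 + h * r2.
  have ef' : f * h = (t - iota t0) * f'.
    rewrite /f' mulrDr mulrA -e ef c0; ring.
  have hf' : gen_alg iota s t f' by apply: gen_add; apply: gen_mul.
  clearbody f'.
  have f'0 : f' != 0.
    by apply/eqP => f'0; move: (mulf_neq0 f0 h0); rewrite ef' f'0 mulr0 eqxx.
  have := congr1 v ef'; rewrite !vM // vh en addr0 => vf1.
  have [|k ek] := IH f' hf' f'0; first by lia.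
  by exists (k + 1); rewrite vf1 ek; ring.
have mult' f : gen_alg iota s t f -> f != 0 -> exists k : int, v f = n * k.
  by move=> hf f0; apply: (mult `|v f|%N) => //; lia.
(* An element of valuation 1 is a quotient of two elements of [K[s, t]], so [n] divides 1. *)
have [w [w0 vw]] : exists w, w != 0 /\ v w = 1 by case: Hv.
have [r1 [r2 [h1 h2 r20 ew]]] := frac w.
have r10 : r1 != 0.
  by apply/eqP => r10; move: w0; rewrite ew r10 mul0r eqxx.
have [k1 e1] := mult' _ h1 r10; have [k2 e2] := mult' _ h2 r20.
have : v (w * r2) = v r1 by rewrite ew divfK.
rewrite vM // vw e1 e2 => e'.
have : n * (k1 - k2) = 1 by rewrite mulrBr -e'; ring.
move: (k1 - k2) => d ed; have : 0 < d by nia.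
by clear e' e1 e2 => d0; nia.
Qed.

(** The cofactor of [f - c] in [f^n - c^n] has the derivative [n c^(n-1)] as residue; through it the
    partial derivatives of the curve equation enter as nonsingularity conditions. *)
Lemma gen_alg_subrX (K F : fieldType) (iota : {rmorphism K -> F})
    s t v f c n :
  is_place iota v -> gen_alg iota s t f -> val_ge v 1 (f - iota c) ->
  exists g, [/\ gen_alg iota s t g, f ^+ n - iota c ^+ n = (f - iota c) * g
    & val_ge v 1 (g - iota (c ^+ n.-1 *+ n))].
Proof.
move=> Hv hf hc; elim: n => [|n [g [hg e hr]]].
  exists (iota 0); split; [exact: gen_const | rewrite !expr0; ring |].
  by rewrite mulr0n subrr; left.
exists (f * g + iota (c ^+ n)); split.
- apply: gen_add; [exact: gen_mul | exact: gen_const].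
- rewrite !exprS mulrDr [(f - _) * (f * g)]mulrCA -e rmorphXn; ring.
- have -> : f * g + iota (c ^+ n) - iota (c ^+ n.+1.-1 *+ n.+1) =
      (f - iota c) * g + iota c * (g - iota (c ^+ n.-1 *+ n)).
    case: n {e hr} => [|n] /=; first by rewrite !expr0 mulr0n mulr1n; ring.
    rewrite -[c ^+ n.+1 *+ n.+2]mulr_natr -[c ^+ n *+ n.+1]mulr_natr exprS.
    rewrite -[n.+2]addn1 natrD; ring.
  have g0 : val_ge v 0 g by apply: val_ge_residue hr.
  apply: (val_geD Hv) => //; last exact: (val_geZ _ Hv).
  by rewrite -[1]addr0; apply: (val_geM Hv).
Qed.

Lemma val_eqV (K F : fieldType) (iota : {rmorphism K -> F}) v n f :
  is_place iota v -> val_eq v n f -> val_eq v (- n) f^-1.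
Proof.
move=> Hv [f0 vf]; split; rewrite ?invr_eq0 //.
have [_ v1] : val_eq v 0 1.
  by rewrite -(rmorph1 iota); apply: val_eq_const => //; apply: oner_neq0.
have [vM _ _ _] := Hv; have := vM f f^-1 f0.
rewrite invr_eq0 f0 divff // v1 vf => /(_ isT); lia.
Qed.

(** * The function field of the curve *)

Lemma ev2E (K F : fieldType) (iota : {rmorphism K -> F}) x y P :
  ev2 iota x y P =
  (map_poly (horner_eval x \o map_poly iota : {rmorphism {poly K} -> F}) P).[y].
Proof. by []. Qed.

Lemma ev2_gen_alg (K F : fieldType) (iota : {rmorphism K -> F}) x y P :
  gen_alg iota x y (ev2 iota x y P).
Proof.
have gen_sum (n : nat) (f : 'I_n -> F) :
    (forall i, gen_alg iota x y (f i)) -> gen_alg iota x y (\sum_i f i).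
  move=> hf; elim/big_ind: _ => //; last exact: gen_add.
  by rewrite -(rmorph0 iota); apply: gen_const.
rewrite /ev2 /map_poly horner_poly; apply: (gen_sum _ _) => i; apply: gen_mul.
  rewrite horner_poly; apply: (gen_sum _ _) => j.
  by apply: gen_mul; [apply: gen_const | apply/gen_algX/gen_fst].
exact/gen_algX/gen_snd.
Qed.

Lemma curve_gen_frac (K F : fieldType) (iota : {rmorphism K -> F}) q m x y :
  is_curve_function_field iota q m x y -> forall f, gen_frac iota x y f.
Proof.
move=> [_ _ frac] f; have [P [Q [Q0 ->]]] := frac f.
by exists (ev2 iota x y P), (ev2 iota x y Q); split=> //; apply: ev2_gen_alg.
Qed.

Lemma curve_eq (K F : fieldType) (iota : {rmorphism K -> F}) q m x y :
  is_curve_function_field iota q m x y ->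
  y ^+ q.+1 = - (x ^+ m * (x ^+ m + 1)).
Proof.
move=> [e _ _]; move: e.
rewrite ev2E /curve_poly rmorphD /= map_polyXn map_polyC /= hornerD hornerXn.
rewrite hornerC /horner_eval rmorphD /= !map_polyXn hornerD !hornerXn.
by move/eqP; rewrite addr_eq0 => /eqP ->; rewrite mul2n -addnn exprD; ring.
Qed.

Lemma size_curve_poly (K : fieldType) q m : size (curve_poly K q m) = q.+2.
Proof.
by rewrite size_polyDl size_polyXn // (leq_ltn_trans (size_polyC_leq1 _)).
Qed.

(** The curve polynomial has [Y]-degree [q + 1], so a nonzero multiple of it cannot have [Y]-degree
    at most [q]. *)
Lemma curve_ev2_neq0 (K F : fieldType) (iota : {rmorphism K -> F}) q m x y
    (P : {poly {poly K}}) :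
  is_curve_function_field iota q m x y ->
  P != 0 -> (size P <= q.+1)%N -> ev2 iota x y P != 0.
Proof.
move=> [_ dv _] P0 sP; apply/eqP => /dv [R eP].
have R0 : R != 0 by apply/eqP => R0; move: P0; rewrite eP R0 mulr0 eqxx.
have C0 : curve_poly K q m != 0 by rewrite -size_poly_gt0 size_curve_poly.
move: sP; rewrite eP size_mul // size_curve_poly addSn /=.
by rewrite -[leqRHS]addn0 leq_add2l leqn0 size_poly_eq0 (negbTE R0).
Qed.

Lemma curve_horner_neq0 (K F : fieldType) (iota : {rmorphism K -> F}) q m x y
    (c : {poly K}) :
  is_curve_function_field iota q m x y -> c != 0 ->
  (map_poly iota c).[x] != 0.
Proof.
move=> Hc c0; have := curve_ev2_neq0 Hc (P := c%:P).
rewrite ev2E map_polyC hornerC /=; apply; first by rewrite polyC_eq0.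
by rewrite (leq_trans (size_polyC_leq1 _)).
Qed.

Lemma curve_x_neq (K F : fieldType) (iota : {rmorphism K -> F}) q m x y c :
  is_curve_function_field iota q m x y -> x != iota c.
Proof.
move=> Hc; have := curve_horner_neq0 Hc (negbT (polyXsubC_eq0 c)).
by rewrite map_polyXsubC hornerXsubC subr_eq0.
Qed.

Lemma curve_x_neq0 (K F : fieldType) (iota : {rmorphism K -> F}) q m x y :
  is_curve_function_field iota q m x y -> x != 0.
Proof. by move=> Hc; rewrite -(rmorph0 iota); apply: curve_x_neq Hc. Qed.

Lemma curve_y_neq0 (K F : fieldType) (iota : {rmorphism K -> F}) q m x y :
  (0 < q)%N -> is_curve_function_field iota q m x y -> y != 0.
Proof.
move=> q0 Hc; have := curve_ev2_neq0 Hc (negbT (polyX_eq0 _)).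
by rewrite size_polyX ev2E map_polyX hornerX; apply.
Qed.

(** * Valuations of [x] and [y] at the poles of [x] *)

(** Over an algebraically closed [K] the polynomial splits into factors [s - z] of nonnegative
    valuation; the product has positive valuation only if some factor does. *)
Lemma val_ge_root (K : closedFieldType) (F : fieldType)
    (iota : {rmorphism K -> F}) v (c : {poly K}) s :
  is_place iota v -> c != 0 -> val_ge v 0 s ->
  val_ge v 1 (map_poly iota c).[s] ->
  exists2 s0, root c s0 & val_ge v 1 (s - iota s0).
Proof.
move=> Hv c0 hs; have [r er] := closed_field_poly_normal c.
have lc0 : lead_coef c != 0 by rewrite lead_coef_eq0.
rewrite {1}er map_polyZ hornerZ => hc.
have {hc} : val_ge v 1 (map_poly iota (\prod_(z <- r) ('X - z%:P))).[s].
  have -> : (map_poly iota (\prod_(z <- r) ('X - z%:P))).[s] =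
      iota (lead_coef c)^-1 *
      (iota (lead_coef c) * (map_poly iota (\prod_(z <- r) ('X - z%:P))).[s]).
    by rewrite mulrA -rmorphM mulVf // rmorph1 mul1r.
  exact: (val_geZ _ Hv).
have {er} : {subset r <= root c}.
  by move=> z zr; rewrite -topredE /= er rootZ // root_prod_XsubC.
elim: r => [|z r IH] sub.
  rewrite big_nil rmorph1 hornerC => /val_ge_le/(_ (oner_neq0 _)).
  have [_] := val_eq_const Hv (oner_neq0 K); rewrite rmorph1 => ->; lia.
rewrite big_cons rmorphM /= hornerM map_polyXsubC hornerXsubC => h.
have [sz0|sz0] := eqVneq (s - iota z) 0.
  exists z; last by left.
  exact: (sub z (mem_head z r)).
have [vz|vz] := boolP (1 <= v (s - iota z)).
  exists z; last by right.
  exact: (sub z (mem_head z r)).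
have hz : val_eq v 0 (s - iota z).
  split=> //; move: vz.
  have : val_ge v 0 (s - iota z).
    by apply: (val_geB Hv) => //; apply: (val_ge_const _ Hv).
  by move/val_ge_le/(_ sz0); lia.
apply: IH; first by move=> z' z'r; apply: sub; rewrite inE z'r orbT.
rewrite -[_.[s]](mulKf sz0) -[1]add0r; apply: (val_geM Hv) => //.
by apply: val_eq_ge; rewrite -oppr0; apply: (val_eqV Hv).
Qed.

(* The functions [s = y^3/x^2] and [t = y/x] satisfy the equation of the curve
   again, and they move the poles of [x] to the points with [t = 0] and
   [s^m = -1]. *)
Lemma curve_pole_values (K : closedFieldType) (F : fieldType)
    (iota : {rmorphism K -> F}) q m x y w :
  q.+1 = (3 * m)%N -> (m%:R : K) != 0 ->
  is_curve_function_field iota q m x y -> is_place iota w ->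
  w x < 0 -> w x = - 3 /\ w y = - 2.
Proof.
move=> qm m0 Hc Hw wx.
have m1 : (0 < m)%N by rewrite lt0n; apply: contraNneq m0 => ->.
have x0 := curve_x_neq0 Hc; have y0 : y != 0 by apply: curve_y_neq0 Hc; lia.
have e := curve_eq Hc.
have hx : val_eq w (w x) x by [].
have hy : val_eq w (w y) y by [].
have hxm := val_eqX m Hw hx.
have hxm1 : val_eq w (m%:Z * w x) (x ^+ m + 1).
  apply: (val_eq_near Hw) hxm _; rewrite addrAC subrr add0r.
  by apply: val_geW (val_ge1 Hw); nia.
(* At a pole of [x] both [x^m] and [x^m + 1] have valuation [m w(x)], so the curve equation gives
   [3m w(y) = 2m w(x)]. *)
have wy : 3 * w y = 2 * w x.
  have [_ w1] := val_eqX q.+1 Hw hy.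
  have [_ w2] : val_eq w (0 + (m%:Z * w x + m%:Z * w x)) (y ^+ q.+1).
    have -> : y ^+ q.+1 = iota (-1) * (x ^+ m * (x ^+ m + 1)) by rewrite e; ring.
    apply: (val_eqM Hw); last exact: (val_eqM Hw).
    by apply: (val_eq_const Hw); rewrite oppr_eq0 oner_neq0.
  move: w1; rewrite w2 qm; nia.
pose t := y / x; pose s := y ^+ 3 / x ^+ 2.
have t0 : t != 0 by rewrite mulf_neq0 ?invr_eq0.
have s0 : s != 0 by rewrite mulf_neq0 ?invr_eq0 ?expf_neq0.
have ht : val_eq w (w y - w x) t by apply: (val_eqM Hw) => //; apply: (val_eqV Hw).
have hs : val_eq w 0 s.
  have -> : 0 = 3%:Z * w y - 2%:Z * w x by lia.
  by apply: (val_eqM Hw); [|apply: (val_eqV Hw)]; apply: (val_eqX _ Hw).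
have x0m : x ^+ m != 0 by rewrite expf_neq0.
have ym : y ^+ (3 * m) = - (x ^+ m * (x ^+ m + 1)) by rewrite -qm.
have sm : s ^+ m = - 1 - (x ^+ m)^-1.
  rewrite /s expr_div_n -!exprM ym mulnC exprM; field; exact: x0m.
have tm : t ^+ (3 * m) = - (s ^+ m * (s ^+ m + 1)).
  rewrite sm /t expr_div_n ym mulnC exprM; field; exact: x0m.
have [c /rootP rc hc] : exists2 c, root ('X^m + 1 : {poly K}) c
    & val_ge w 1 (s - iota c).
  apply: (val_ge_root Hw); last 1 first.
  - rewrite rmorphD rmorph1 /= map_polyXn hornerD hornerXn hornerC sm.
    rewrite addrAC addNr add0r; apply: (val_geN Hw).
    by apply: val_geW (val_eq_ge (val_eqV Hw hxm)); nia.
  - by rewrite -size_poly_gt0 size_polyDl size_polyXn // size_poly1.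
  - exact: val_eq_ge.
have cm : c ^+ m = -1.
  by move: rc; rewrite hornerD hornerXn hornerC => /eqP; rewrite addr_eq0 => /eqP.
have frac f : gen_frac iota s t f.
  have [r1 [r2 [h1 h2 r20 ->]]] := curve_gen_frac Hc f.
  have gs : gen_frac iota s t s by apply/gen_alg_frac/gen_fst.
  have gt : gen_frac iota s t t by apply/gen_alg_frac/gen_snd.
  have gx : gen_frac iota s t x.
    have -> : x = s * (t * t * t)^-1 by rewrite /s /t; field; rewrite y0 x0.
    by apply: gen_fracM => //; apply: gen_fracV; do 2![apply: gen_fracM => //].
  have gy : gen_frac iota s t y.
    have -> : y = x * t by rewrite /t; field.
    exact: gen_fracM.
  by apply: gen_fracM; [|apply: gen_fracV]; apply: gen_frac_alg gx gy _.
have [g1 [h1 e1 r1]] := gen_alg_subrX (2 * m) Hw (gen_fst iota s t) hc.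
have [g2 [h2 e2 r2]] := gen_alg_subrX m Hw (gen_fst iota s t) hc.
(* As [c^(2m) + c^m = 0], the equation reads [(s - c) (g1 + g2) = - t^(3m)]. *)
have wt : w (t - iota 0) = 1.
  apply: (@val_local_param _ _ _ s t c 0 w (g1 + g2) (- t ^+ (3 * m).-1)) => //.
  - by rewrite rmorph0 subr0; right; move: ht => [_ ->]; lia.
  - by rewrite rmorph0.
  - exact: gen_add.
  - have -> : - t ^+ (3 * m).-1 = iota (-1) * t ^+ (3 * m).-1 by ring.
    by apply: gen_mul; [apply: gen_const | apply/gen_algX/gen_snd].
  (* [d] is the derivative of [S^(2m) + S^m] at [c]; it equals [- m c^(m-1)] because [c^m = -1]. *)
  - pose d : K := c ^+ (2 * m).-1 *+ (2 * m) + c ^+ m.-1 *+ m.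
    have c0 : c != 0.
      apply: contra_eq_neq cm => ->; rewrite expr0n eqn0Ngt m1 /= eq_sym oppr_eq0.
      exact: oner_neq0.
    have d0 : d != 0.
      have -> : d = - (c ^+ m.-1 * m%:R).
        rewrite /d (_ : (2 * m).-1 = m + m.-1)%N; last by lia.
        rewrite exprD cm -[_ *+ (2 * m)]mulr_natr -[_ *+ m]mulr_natr natrM; ring.
      by rewrite oppr_eq0 mulf_neq0 // expf_neq0.
    apply: (val_eq_unit Hw d0); rewrite /d rmorphD opprD addrACA.
    exact: (val_geD Hw).
  - rewrite mulrDr -e1 -e2 rmorph0 subr0 mulrN -exprS prednK; last by lia.
    by rewrite tm mul2n -addnn !exprD -rmorphXn cm; ring.
(* [w(y) - w(x) = 1] and [3 w(y) = 2 w(x)] determine both values. *)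
move: wt; rewrite rmorph0 subr0; move: ht => [_ ->]; lia.
Qed.

(** * The spaces [L(k D_infty)] *)

(** Membership in [L(k D_infty)] with the case [f = 0] moved inside each place, so that closure
    properties come directly from [val_ge]. *)
Definition pole_le (K F : fieldType) (iota : K -> F) (x : F) (k : nat) (f : F) :
    Prop :=
  forall w, is_place iota w -> val_ge w (if w x < 0 then - k%:Z else 0) f.

Lemma pole_le_in_L (K F : fieldType) (iota : K -> F) x k f :
  pole_le iota x k f -> in_L_Dinf iota x k f.
Proof.
move=> h; have [->|f0] := eqVneq f 0; first by left.
by right=> w Hw; apply: val_ge_le (h w Hw) f0.
Qed.

Lemma pole_leD (K F : fieldType) (iota : {rmorphism K -> F}) x k f g :
  pole_le iota x k f -> pole_le iota x k g -> pole_le iota x k (f + g).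
Proof. by move=> hf hg w Hw; apply: (val_geD Hw); [apply: hf | apply: hg]. Qed.

Lemma pole_leZ (K F : fieldType) (iota : {rmorphism K -> F}) x k c f :
  pole_le iota x k f -> pole_le iota x k (iota c * f).
Proof. by move=> hf w Hw; apply: (val_geZ _ Hw); apply: hf. Qed.

Lemma pole_leM (K F : fieldType) (iota : {rmorphism K -> F}) x k l f g :
  pole_le iota x k f -> pole_le iota x l g -> pole_le iota x (k + l) (f * g).
Proof.
move=> hf hg w Hw; have := val_geM Hw (hf w Hw) (hg w Hw).
by case: ifP => _; [apply: val_geW; lia | rewrite addr0].
Qed.

Lemma pole_le1 (K F : fieldType) (iota : {rmorphism K -> F}) x k :
  pole_le iota x k 1.
Proof. by move=> w Hw; apply: val_geW (val_ge1 Hw); case: ifP => _ //; lia. Qed.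

Lemma pole_le_x (K : closedFieldType) (F : fieldType)
    (iota : {rmorphism K -> F}) q m x y :
  q.+1 = (3 * m)%N -> (m%:R : K) != 0 ->
  is_curve_function_field iota q m x y -> pole_le iota x 3 x.
Proof.
move=> qm m0 Hc w Hw; right; case: ifP => [wx|]; last by lia.
by have [-> _] := curve_pole_values qm m0 Hc Hw wx.
Qed.

(** Away from the poles of [x], the power [y^(q+1)] is a polynomial in [x], hence [y] is integral
    there; at the poles the valuation is [-2]. *)
Lemma pole_le_y (K : closedFieldType) (F : fieldType)
    (iota : {rmorphism K -> F}) q m x y :
  q.+1 = (3 * m)%N -> (m%:R : K) != 0 ->
  is_curve_function_field iota q m x y -> pole_le iota x 3 y.
Proof.
move=> qm m0 Hc w Hw; right; case: ifP => [wx|/negbT wx].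
  by have [_ ->] := curve_pole_values qm m0 Hc Hw wx.
have y0 : y != 0 by apply: curve_y_neq0 Hc; lia.
have hx : val_ge w 0%:Z x by right; lia.
have hxm : val_ge w 0 (x ^+ m) by have := val_geX m Hw hx; rewrite muln0.
have := curve_eq Hc; have [_ wy] := val_eqX q.+1 Hw (conj y0 erefl).
move=> e; have : val_ge w 0 (y ^+ q.+1).
  rewrite e; apply: (val_geN Hw); rewrite -[0]addr0; apply: (val_geM Hw) => //.
  by apply: (val_geD Hw) => //; apply: val_ge1 Hw.
by move/val_ge_le/(_ (expf_neq0 _ y0)); rewrite wy; nia.
Qed.

(** * Lifting to [L(3k D_infty)] modulo order [q] *)

(** [h] itself may have larger poles; the precision [q] is the one with which Frobenius replaces
    [x^q] and [y^q] by constants. *)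
Definition liftable (K F : fieldType) (iota : K -> F) (x : F) (v : F -> int)
    (q k : nat) (h : F) : Prop :=
  exists2 f, pole_le iota x (3 * k) f & val_ge v q%:Z (f - h).

Lemma liftableD (K F : fieldType) (iota : {rmorphism K -> F}) x v q k h h' :
  is_place iota v -> liftable iota x v q k h -> liftable iota x v q k h' ->
  liftable iota x v q k (h + h').
Proof.
move=> Hv [f hf e] [f' hf' e']; exists (f + f'); first exact: pole_leD.
by rewrite opprD addrACA; apply: (val_geD Hv).
Qed.

Lemma liftableZ (K F : fieldType) (iota : {rmorphism K -> F}) x v q k c h :
  is_place iota v -> liftable iota x v q k h ->
  liftable iota x v q k (iota c * h).
Proof.
move=> Hv [f hf e]; exists (iota c * f); first exact: pole_leZ.
by rewrite -mulrBr; apply: (val_geZ _ Hv).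
Qed.

(** Since [v] is not a pole of [x], both lifts, and hence [h], are integral at [v], so congruences
    modulo order [q] can be multiplied. *)
Lemma liftableM (K F : fieldType) (iota : {rmorphism K -> F}) x v q k l h h' :
  is_place iota v -> 0 <= v x ->
  liftable iota x v q k h -> liftable iota x v q l h' ->
  liftable iota x v q (k + l) (h * h').
Proof.
move=> Hv vx [f hf e] [f' hf' e']; exists (f * f').
  by rewrite mulnDr; apply: pole_leM.
have f0 : val_ge v 0 f by have := hf v Hv; rewrite ltNge vx.
have f0' : val_ge v 0 f' by have := hf' v Hv; rewrite ltNge vx.
have h0 : val_ge v 0 h.
  rewrite -[h](subKr f); apply: (val_geB Hv) => //.
  by apply: val_geW e.
have -> : f * f' - h * h' = h * (f' - h') + (f - h) * f' by ring.
apply: (val_geD Hv); first by rewrite -[q%:Z]add0r; apply: (val_geM Hv).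
by rewrite -[q%:Z]addr0; apply: (val_geM Hv).
Qed.

(** * Binary forms on the nodal cubic *)

(* The binary forms of degree [3k] taking equal values at [(1 : 0)] and
   [(0 : 1)] are the restrictions of forms of degree [k] to a plane nodal
   cubic. *)
Lemma nodal_cubic_forms (F : fieldType) (S : nat -> F -> Prop) (l1 l2 : F) :
  (forall k f g, S k f -> S k g -> S k (f + g)) ->
  (forall k f, S k f -> S k (- f)) ->
  (forall k f g, S k f -> S 1%N g -> S k.+1 (f * g)) ->
  S 1%N (l1 ^+ 3 + l2 ^+ 3) -> S 1%N (l1 ^+ 2 * l2) -> S 1%N (l1 * l2 ^+ 2) ->
  forall k, S k.+1 (l1 ^+ (3 * k.+1) + l2 ^+ (3 * k.+1)) /\
    forall i j, (0 < i)%N -> (0 < j)%N -> (i + j = 3 * k.+1)%N ->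
      S k.+1 (l1 ^+ i * l2 ^+ j).
Proof.
move=> SD SN SM S0 S1 S2; elim=> [|k [IH0 IH]].
  split=> // -[|[|[|i]]] [|[|[|j]]] // _ _ e; try lia.
(* [up1] and [up2] together reach every mixed monomial of the next degree whose exponents are both
   at least 2. *)
have up1 i j : (0 < i)%N -> (0 < j)%N -> (i + j = 3 * k.+1)%N ->
    S k.+2 (l1 ^+ i.+2 * l2 ^+ j.+1).
  move=> i0 j0 ij; have -> : l1 ^+ i.+2 * l2 ^+ j.+1 =
      (l1 ^+ i * l2 ^+ j) * (l1 ^+ 2 * l2).
    rewrite -[i.+2]addn2 -[j.+1]addn1 !exprD; ring.
  by apply: (SM) => //; apply: IH.
have up2 i j : (0 < i)%N -> (0 < j)%N -> (i + j = 3 * k.+1)%N ->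
    S k.+2 (l1 ^+ i.+1 * l2 ^+ j.+2).
  move=> i0 j0 ij; have -> : l1 ^+ i.+1 * l2 ^+ j.+2 =
      (l1 ^+ i * l2 ^+ j) * (l1 * l2 ^+ 2).
    rewrite -[j.+2]addn2 -[i.+1]addn1 !exprD; ring.
  by apply: (SM) => //; apply: IH.
set n := (3 * k.+1)%N in IH0 IH up1 up2 *.
have en : (3 * k.+2)%N = (n + 3)%N by rewrite /n; lia.
have n3 : (3 <= n)%N by rewrite /n; lia.
clearbody n; rewrite {}en.
(* For an exponent 1, [l1 l2^(n+2)] is [(l1^n + l2^n) l1 l2^2] minus the monomial [l1^(n+1) l2^2]
   already reached; symmetrically for [l1^(n+2) l2]. *)
have mid i j : (0 < i)%N -> (0 < j)%N -> (i + j = n + 3)%N ->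
    S k.+2 (l1 ^+ i * l2 ^+ j).
  case: i => [|[|[|i]]] // _; case: j => [|[|[|j]]] // _ ij; try lia.
  - have -> : l1 ^+ 1 * l2 ^+ j.+3 =
        (l1 ^+ n + l2 ^+ n) * (l1 * l2 ^+ 2) - l1 ^+ n.-1.+2 * l2 ^+ 1.+1.
      have -> : j.+3 = (n + 2)%N by lia.
      have -> : n.-1.+2 = (n + 1)%N by lia.
      rewrite !exprD; ring.
    apply: (SD); first exact: SM.
    by apply: SN; apply: up1; lia.
  - by apply: up2; lia.
  - have -> : l1 ^+ i.+3 * l2 ^+ 1 =
        (l1 ^+ n + l2 ^+ n) * (l1 ^+ 2 * l2) - l1 ^+ 1.+1 * l2 ^+ n.-1.+2.
      have -> : i.+3 = (n + 2)%N by lia.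
      have -> : n.-1.+2 = (n + 1)%N by lia.
      rewrite !exprD; ring.
    apply: (SD); first exact: SM.
    by apply: SN; apply: up2; lia.
  - by apply: up1; lia.
  - by apply: up1; lia.
split=> //; have -> : l1 ^+ (n + 3) + l2 ^+ (n + 3) =
    (l1 ^+ n + l2 ^+ n) * (l1 ^+ 3 + l2 ^+ 3)
    - (l1 ^+ n * l2 ^+ 3 + l1 ^+ 3 * l2 ^+ n) by rewrite !exprD; ring.
apply: (SD); first exact: SM.
by apply: SN; apply: SD; apply: mid; lia.
Qed.

(** The pure powers in the expansion have coefficients [c be^n] and [d ga^n], which agree by
    hypothesis; all other monomials are mixed. *)
Lemma binary_form_power (K F : fieldType) (iota : {rmorphism K -> F})
    (S : F -> Prop) (l1 l2 : F) (be ga c d : K) n :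
  (forall f g, S f -> S g -> S (f + g)) ->
  (forall c f, S f -> S (iota c * f)) ->
  S (l1 ^+ n.+1 + l2 ^+ n.+1) ->
  (forall i j, (0 < i)%N -> (0 < j)%N -> (i + j = n.+1)%N ->
    S (l1 ^+ i * l2 ^+ j)) ->
  c * be ^+ n = d * ga ^+ n ->
  S ((iota be * l1 + iota ga * l2) ^+ n * (iota c * l1 + iota d * l2)).
Proof.
move=> SD SZ S0 Smid e; set t := _ + _.
(* Instead of a binomial expansion, one factor [t] is opened at a time; a mixed monomial stays
   mixed. *)
have mid k : forall i j, (0 < i)%N -> (0 < j)%N -> (k + i + j = n.+1)%N ->
    S (t ^+ k * (l1 ^+ i * l2 ^+ j)).
  elim: k => [|k IH] i j i0 j0 ij; first by rewrite mul1r; apply: Smid.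
  have -> : t ^+ k.+1 * (l1 ^+ i * l2 ^+ j) =
      iota be * (t ^+ k * (l1 ^+ i.+1 * l2 ^+ j)) +
      iota ga * (t ^+ k * (l1 ^+ i * l2 ^+ j.+1)) by rewrite !exprS /t; ring.
  by apply: (SD); apply: (SZ); apply: (IH) => //; lia.
have end1 k : forall i, (0 < i)%N -> (k + i = n.+1)%N ->
    S (t ^+ k * l1 ^+ i - iota (be ^+ k) * l1 ^+ n.+1).
  elim: k => [|k IH] i i0 ik.
    (* [0] lies in [S] as the multiple by 0 of a known member. *)
    rewrite -ik !expr0 rmorph1 subrr -[0](mul0r (l1 ^+ n.+1 + l2 ^+ n.+1)).
    by rewrite -(rmorph0 iota); apply: SZ.
  have -> : t ^+ k.+1 * l1 ^+ i - iota (be ^+ k.+1) * l1 ^+ n.+1 =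
      iota be * (t ^+ k * l1 ^+ i.+1 - iota (be ^+ k) * l1 ^+ n.+1) +
      iota ga * (t ^+ k * (l1 ^+ i * l2 ^+ 1)).
    rewrite [t ^+ k.+1]exprS {1}/t [be ^+ k.+1]exprS [l1 ^+ i.+1]exprS; ring.
  apply: (SD); apply: (SZ); first by apply: (IH) => //; lia.
  by apply: (mid) => //; lia.
have end2 k : forall i, (0 < i)%N -> (k + i = n.+1)%N ->
    S (t ^+ k * l2 ^+ i - iota (ga ^+ k) * l2 ^+ n.+1).
  elim: k => [|k IH] i i0 ik.
    rewrite -ik !expr0 rmorph1 subrr -[0](mul0r (l1 ^+ n.+1 + l2 ^+ n.+1)).
    by rewrite -(rmorph0 iota); apply: SZ.
  have -> : t ^+ k.+1 * l2 ^+ i - iota (ga ^+ k.+1) * l2 ^+ n.+1 =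
      iota ga * (t ^+ k * l2 ^+ i.+1 - iota (ga ^+ k) * l2 ^+ n.+1) +
      iota be * (t ^+ k * (l1 ^+ 1 * l2 ^+ i)).
    rewrite [t ^+ k.+1]exprS {1}/t [ga ^+ k.+1]exprS [l2 ^+ i.+1]exprS; ring.
  apply: (SD); apply: (SZ); first by apply: (IH) => //; lia.
  by apply: (mid) => //; lia.
have -> : t ^+ n * (iota c * l1 + iota d * l2) =
    iota c * (t ^+ n * l1 ^+ 1 - iota (be ^+ n) * l1 ^+ n.+1) +
    iota d * (t ^+ n * l2 ^+ 1 - iota (ga ^+ n) * l2 ^+ n.+1) +
    iota (c * be ^+ n) * (l1 ^+ n.+1 + l2 ^+ n.+1).
  rewrite [in iota (c * _)]e !rmorphM.
  have : iota c * iota (be ^+ n) = iota d * iota (ga ^+ n) by rewrite -!rmorphM e.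
  set B := iota (be ^+ n); set G := iota (ga ^+ n) => eBG.
  have -> : iota d * G * (l1 ^+ n.+1 + l2 ^+ n.+1) =
    iota c * B * l1 ^+ n.+1 + iota d * G * l2 ^+ n.+1 by rewrite eBG mulrDr.
  ring.
apply: (SD); last exact: SZ.
by apply: (SD); apply: (SZ); [apply: end1 | apply: end2]; rewrite ?addn1.
Qed.

(** * Uniformizers at [P] and Frobenius lifts *)

(** The [y]-derivative of the curve equation at [P] is [(q + 1) b^q = b^q], which is nonzero, so
    [x - a] is a local parameter. *)
Lemma curve_val_x (K F : fieldType) (iota : {rmorphism K -> F})
    q m x y (a b : K) v :
  (q%:R : K) = 0 -> b != 0 ->
  is_curve_function_field iota q m x y ->
  b ^+ q.+1 = - (a ^+ m * (a ^+ m + 1)) -> is_place iota v ->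
  val_ge v 1 (x - iota a) -> val_ge v 1 (y - iota b) ->
  val_eq v 1 (x - iota a).
Proof.
move=> q0 b0 Hc eb Hv hx hy.
have xa := curve_x_neq a Hc; split; first by rewrite subr_eq0.
have [h [ah eh rh]] := gen_alg_subrX q.+1 Hv (gen_fst iota y x) hy.
have [g1 [ag1 eg1 _]] := gen_alg_subrX (2 * m) Hv (gen_snd iota y x) hx.
have [g2 [ag2 eg2 _]] := gen_alg_subrX m Hv (gen_snd iota y x) hx.
apply: (@val_local_param _ _ _ y x b a v h (iota (-1) * (g1 + g2))) => //.
- move=> f; have [r1 [r2 [h1 h2 r20 ->]]] := curve_gen_frac Hc f.
  have gx : gen_frac iota y x x by apply/gen_alg_frac/gen_snd.
  have gy : gen_frac iota y x y by apply/gen_alg_frac/gen_fst.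
  by apply: gen_fracM; [|apply: gen_fracV]; apply: gen_frac_alg gx gy _.
- by apply: gen_mul; [apply: gen_const | apply: gen_add].
- apply: (val_eq_unit Hv) rh.
  by rewrite -mulr_natr -addn1 natrD q0 add0r mulr1 expf_neq0.
- rewrite mulrCA mulrDr -eh -eg1 -eg2 (curve_eq Hc) -!rmorphXn eb.
  by rewrite mul2n -addnn !exprD !(rmorphN, rmorphM, rmorphD, rmorph1); ring.
Qed.

(** The derivative [m a^(m-1)] of [x^m] at [a] is nonzero, so [x^m] is unramified there. *)
Lemma curve_val_xm (K F : fieldType) (iota : {rmorphism K -> F})
    m x (a : K) v :
  (m%:R : K) != 0 -> a != 0 -> is_place iota v ->
  val_eq v 1 (x - iota a) -> val_eq v 1 (x ^+ m - iota (a ^+ m)).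
Proof.
move=> m0 a0 Hv hx.
have [g [_ e r]] := gen_alg_subrX m Hv (gen_fst iota x x) (val_eq_ge hx).
rewrite rmorphXn e -[1]addr0; apply: (val_eqM Hv) => //.
by apply: (val_eq_unit Hv) r; rewrite -mulr_natr mulf_neq0 ?expf_neq0.
Qed.

(* Frobenius: [x^(3m) = x * x^q] agrees with [a^q x] up to order [q], and
   [x^(2m) + x^m = - y * y^q] agrees with [- b^q y]. *)
Lemma liftable_degree1 (K : closedFieldType) (F : fieldType)
    (iota : {rmorphism K -> F}) q m x y (a b : K) v (c1 c2 c3 : K) :
  q.+1 = (3 * m)%N -> [pchar F].-nat q -> (m%:R : K) != 0 ->
  is_curve_function_field iota q m x y -> is_place iota v ->
  val_ge v 1 (x - iota a) -> val_ge v 1 (y - iota b) ->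
  liftable iota x v q 1
    (iota c1 * (x ^+ m) ^+ 3 + iota c2 * ((x ^+ m) ^+ 2 + x ^+ m) + iota c3).
Proof.
move=> qm chq m0 Hc Hv hx hy.
have frob f c : val_ge v 1 (f - iota c) ->
    val_ge v q%:Z (iota (c ^+ q) * f - f ^+ q.+1).
  (* By Frobenius [f^q - c^q = (f - c)^q], which has valuation at least [q]. *)
  move=> hf; have -> : iota (c ^+ q) * f - f ^+ q.+1 = - (f * (f - iota c) ^+ q).
    have e : f ^+ q = (f - iota c) ^+ q + iota c ^+ q.
      by rewrite -exprDn_pchar // subrK.
    by rewrite exprS [in f * f ^+ q]e rmorphXn; ring.
  apply: (val_geN Hv); rewrite -[q%:Z]add0r; apply: (val_geM Hv).
    exact: val_ge_residue hf.
  by rewrite -[q in q%:Z]muln1; apply: (val_geX _ Hv).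
have l3 : liftable iota x v q 1 ((x ^+ m) ^+ 3).
  exists (iota (a ^+ q) * x); first exact/pole_leZ/pole_le_x/Hc.
  by rewrite -exprM mulnC -qm; apply: frob.
have l2 : liftable iota x v q 1 (- y ^+ q.+1).
  exists (- (iota (b ^+ q) * y)).
    by rewrite -mulNr -rmorphN; apply/pole_leZ/pole_le_y/Hc.
  by rewrite -opprD; apply: (val_geN Hv); apply: frob.
have l1 : liftable iota x v q 1 1.
  by exists 1; [apply: pole_le1 | rewrite subrr; left].
have -> : (x ^+ m) ^+ 2 + x ^+ m = - y ^+ q.+1.
  by rewrite (curve_eq Hc) opprK; ring.
rewrite -[iota c3]mulr1.
by apply: (liftableD Hv); [apply: (liftableD Hv)|]; apply: (liftableZ _ Hv).
Qed.

(** Once [z^2 = - z - 1], each of the three cubic generators has equal coefficients at [T^2] and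
    [T], hence lies in the span of [T^3], [T^2 + T] and [1]. *)
Lemma liftable_forms (K : closedFieldType) (F : fieldType)
    (iota : {rmorphism K -> F}) q m x y (z a b : K) v (l1 l2 : F) k :
  q.+1 = (3 * m)%N -> [pchar F].-nat q -> (m%:R : K) != 0 ->
  is_curve_function_field iota q m x y -> is_place iota v ->
  val_ge v 1 (x - iota a) -> val_ge v 1 (y - iota b) ->
  z ^+ 2 + z + 1 = 0 ->
  l1 = x ^+ m - iota z -> l2 = iota (z ^+ 2) - x ^+ m ->
  liftable iota x v q k.+1 (l1 ^+ (3 * k.+1) + l2 ^+ (3 * k.+1)) /\
    forall i j, (0 < i)%N -> (0 < j)%N -> (i + j = 3 * k.+1)%N ->
      liftable iota x v q k.+1 (l1 ^+ i * l2 ^+ j).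
Proof.
move=> qm chq m0 Hc Hv hx hy hz -> ->.
have lin c1 c2 c3 := liftable_degree1 c1 c2 c3 qm chq m0 Hc Hv hx hy.
have x0 : 0 <= v x.
  by apply: val_ge_le (val_ge_residue Hv hx) (curve_x_neq0 Hc).
have e : iota (z ^+ 2) = - iota z - 1.
  rewrite -rmorphN -(rmorph1 iota) -rmorphB; congr (iota _).
  by apply/eqP; rewrite -subr_eq0 -hz; apply/eqP; ring.
have hw : iota z ^+ 2 + iota z + 1 = 0 by rewrite -rmorphXn e; ring.
rewrite e; move: (x ^+ m) lin => T lin.
apply: (nodal_cubic_forms (S := liftable iota x v q)).
- by move=> k' f g; apply: liftableD.
- move=> k' f hf; have -> : - f = iota (-1) * f by ring.
  exact: (liftableZ _ Hv).
- by move=> k' f g hf hg; rewrite -[k'.+1]addn1; apply: liftableM.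
(* This identity and the next two hold modulo [z^2 + z + 1]; the explicit multiple turns them into
   polynomial identities. *)
- have -> : (T - iota z) ^+ 3 + (- iota z - 1 - T) ^+ 3 =
      iota 0 * T ^+ 3 + iota (- (3%:R + 6%:R * z)) * (T ^+ 2 + T) + iota 0
      - (2%:R * iota z + 1) * (iota z ^+ 2 + iota z + 1) by ring.
  by rewrite hw mulr0 subr0.
- have -> : (T - iota z) ^+ 2 * (- iota z - 1 - T) =
      iota (-1) * T ^+ 3 + iota (z - 1) * (T ^+ 2 + T) + iota z
      + (T - iota z) * (iota z ^+ 2 + iota z + 1) by ring.
  by rewrite hw mulr0 addr0.
- have -> : (T - iota z) * (- iota z - 1 - T) ^+ 2 =
      iota 1 * T ^+ 3 + iota (2%:R + z) * (T ^+ 2 + T) + iota (1 + z)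
      - (T + 1 + iota z) * (iota z ^+ 2 + iota z + 1) by ring.
  by rewrite hw mulr0 subr0.
Qed.

(** An error of order [q > N] does not affect the valuation [N]. *)
Lemma liftable_val_eq (K F : fieldType) (iota : {rmorphism K -> F})
    x v q k N h :
  is_place iota v -> liftable iota x v q k h -> val_eq v N%:Z h -> (N < q)%N ->
  exists f : F, [/\ f != 0, in_L_Dinf iota x (3 * k) f & v f = N%:Z].
Proof.
move=> Hv [f hf e] hh Nq; have [f0 vf] : val_eq v N%:Z f.
  by apply: (val_eq_near Hv) hh _; apply: val_geW e; lia.
by exists f; split=> //; apply: pole_le_in_L.
Qed.

(** * The [P]-order in terms of [a^m] *)

(** With [A = a^m] and [al] its [alphaP], [A - z^2 = - (1 + A) z (al + z)] and
    [A - z = - (1 + A) z^2 (al + z^2)]; cubing removes the factors [z] and [z^2], and the common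
    factor cancels. *)
Lemma Pval_eq0 (K : fieldType) (z a : K) m k :
  z ^+ 2 + z + 1 = 0 -> z - z ^+ 2 != 0 -> (3%:R : K) != 0 ->
  a ^+ m != 0 -> 1 + a ^+ m != 0 ->
  (Pval z k (alphaP m a) == 0) =
  ((a ^+ m - z ^+ 2) ^+ (3 * k) == (a ^+ m - z) ^+ (3 * k)).
Proof.
rewrite /Pval /alphaP; move: (a ^+ m) => A hz dz n3 A0 A1.
have z2 : z ^+ 2 = - z - 1.
  by apply/eqP; rewrite -subr_eq0 -hz; apply/eqP; ring.
have c3 : A - z ^+ 2 = - (1 + A) * z * (A / (1 + A) + z).
  have -> : - (1 + A) * z * (A / (1 + A) + z) = - z * (A + z * (1 + A)).
    by field.
  have -> : - z * (A + z * (1 + A)) = - A * (z + z ^+ 2) - z ^+ 2 by ring.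
  rewrite z2; ring.
have c3' : A - z = - (1 + A) * z ^+ 2 * (A / (1 + A) + z ^+ 2).
  have -> : - (1 + A) * z ^+ 2 * (A / (1 + A) + z ^+ 2) =
    - z ^+ 2 * (A + z ^+ 2 * (1 + A)) by field.
  have -> : - z ^+ 2 * (A + z ^+ 2 * (1 + A)) =
    - z ^+ 2 * (1 + z ^+ 2) * A - (z ^+ 2) ^+ 2 by ring.
  rewrite z2; have -> : - (- z - 1) * (1 + (- z - 1)) * A - (- z - 1) ^+ 2 =
    - (z ^+ 2 + z) * A - (z ^+ 2 + z + z + 1) by ring.
  rewrite z2; ring.
have z3 : z ^+ 3 = 1.
  have -> : z ^+ 3 = (z - 1) * (z ^+ 2 + z + 1) + 1 by ring.
  by rewrite hz mulr0 add0r.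
have d0 : 3%:R * (z - z ^+ 2) * (A / (1 + A)) * (A / (1 + A) - 1) != 0.
  have -> : A / (1 + A) - 1 = - (1 + A)^-1 by field.
  by rewrite !mulf_neq0 ?oppr_eq0 ?invr_eq0.
have cube (r s t : K) : (r * s * t) ^+ 3 = r ^+ 3 * s ^+ 3 * t ^+ 3 by ring.
rewrite mulf_eq0 invr_eq0 (negbTE d0) orbF subr_eq0 c3 c3' !exprM !cube z3.
have -> : (z ^+ 2) ^+ 3 = 1 by rewrite -exprM mulnC exprM z3 expr1n.
rewrite !mulr1 [X in _ = (X == _)]exprMn [X in _ = (_ == X)]exprMn.
by rewrite (inj_eq (mulfI _)) // !expf_neq0 // oppr_eq0.
Qed.

(** * The functions with prescribed order at [P] *)

Theorem theorem3p9 (p e q m : nat) (K : closedFieldType) (F : fieldType)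
    (iota : {rmorphism K -> F}) (x y : F) (z a b : K) (v : F -> int) (i : nat) :
  prime p -> (0 < e)%N -> q = (p ^ e)%N -> (q %% 3 = 2)%N -> m = ((q + 1) %/ 3)%N ->
  p \in [pchar K] ->
  (forall c : K, exists n : nat, (0 < n)%N /\ c ^+ (p ^ n) = c) ->
  is_curve_function_field iota q m x y ->
  3.-primitive_root z ->
  b ^+ q.+1 + a ^+ (2 * m) + a ^+ m = 0 ->
  a != 0 ->
  ~~ ((a ^+ m + 1 == 0) && (b == 0)) ->
  is_place iota v -> 0 < v (x - iota a) -> 0 < v (y - iota b) ->
  (alphaP m a) ^+ 2 - alphaP m a + 1 != 0 ->
  is_Porder z (alphaP m a) i ->
  ((i + 2 <= m)%N ->
     exists f : F, [/\ f != 0, in_L_Dinf iota x (3 * i + 3) f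
                     & v f = (3 * i + 3)%:Z])
  /\ (forall j : nat, (j + 1 <= i)%N -> (j + 2 <= m)%N ->
     exists f : F, [/\ f != 0, in_L_Dinf iota x (3 * j + 3) f
                     & v f = (3 * j + 2)%:Z]).
Proof.
move=> p_pr e0 eq_q q3 em chp _ Hc prim_z eb a0 abO Hv vx vy _ [i0 Pi Pk].
have qm : q.+1 = (3 * m)%N by lia.
have succ n : (3 * n + 3 = 3 * n.+1)%N by lia.
(* Here [q = 3m - 1], so the wanted orders stay below the precision [q]. *)
have lt_q n : (n + 2 <= m)%N -> (3 * n + 3 < q)%N by lia.
have q0 : (q%:R : K) = 0.
  by apply/eqP; rewrite -(dvdn_pcharf chp) eq_q dvdn_exp.
have chq : [pchar F].-nat q.
  rewrite eq_q pnatX (_ : _.-nat p) // pnatE //.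
  by rewrite (fmorph_pchar iota).
(* In [K], [3m = q + 1 = 1], so both 3 and [m] are invertible. *)
have m3 : (3%:R * m%:R : K) = 1 by rewrite -natrM -qm -addn1 natrD q0 add0r.
have m0 : (m%:R : K) != 0.
  by apply: contra_eq_neq m3 => ->; rewrite mulr0 eq_sym oner_neq0.
have n3 : (3%:R : K) != 0.
  by apply: contra_eq_neq m3 => ->; rewrite mul0r eq_sym oner_neq0.
have z1 : z != 1.
  by rewrite -[z]expr1 -(prim_order_dvd prim_z).
have hz : z ^+ 2 + z + 1 = 0.
  apply: (mulfI (x := z - 1)); first by rewrite subr_eq0.
  have -> : (z - 1) * (z ^+ 2 + z + 1) = z ^+ 3 - 1 by ring.
  by rewrite (prim_expr_order prim_z) subrr mulr0.
have z0 : z != 0.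
  by apply: contra_eq_neq hz => ->; rewrite expr0n /= !add0r oner_neq0.
have dz : z - z ^+ 2 != 0.
  have -> : z - z ^+ 2 = z * - (z - 1) by ring.
  by rewrite mulf_neq0 // oppr_eq0 subr_eq0.
have A0 : a ^+ m != 0 by rewrite expf_neq0.
have eb' : b ^+ q.+1 = - (a ^+ m * (a ^+ m + 1)).
  move: eb; rewrite -addrA => /eqP; rewrite addr_eq0 => /eqP ->.
  by rewrite mul2n -addnn exprD; ring.
have bq : (b ^+ q.+1 == 0) = (b == 0) by rewrite expf_eq0.
have A1' : a ^+ m + 1 != 0.
  by apply: contra abO => /eqP A1; rewrite A1 eqxx -bq eb' A1 mulr0 oppr0 eqxx.
have A1 : 1 + a ^+ m != 0 by rewrite addrC.
have b0 : b != 0 by rewrite -bq eb' oppr_eq0 mulf_neq0.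
have hx : val_ge v 1 (x - iota a) by right; rewrite -gtz0_ge1.
have hy : val_ge v 1 (y - iota b) by right; rewrite -gtz0_ge1.
clear eq_q q3 em eb abO vx vy.
have hT := curve_val_xm m0 a0 Hv (curve_val_x q0 b0 Hc eb' Hv hx hy).
have PE k := Pval_eq0 k hz dz n3 A0 A1.
set A := a ^+ m in hT PE; set T := x ^+ m in hT.
pose l1 := T - iota z; pose l2 := iota (z ^+ 2) - T.
(* The linear form in [l1], [l2] vanishing at [T = A], a multiple of the uniformizer [T - A]. *)
have tau : iota (A - z ^+ 2) * l1 + iota (A - z) * l2 =
    iota (z - z ^+ 2) * (T - iota A) by rewrite /l1 /l2; ring.
have lift k c d : c * (A - z ^+ 2) ^+ (3 * k + 2) = d * (A - z) ^+ (3 * k + 2) ->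
    liftable iota x v q k.+1
      ((iota (z - z ^+ 2) * (T - iota A)) ^+ (3 * k + 2) *
       (iota c * l1 + iota d * l2)).
  move=> ecd; rewrite -tau.
  have [h0 h1] := liftable_forms k qm chq m0 Hc Hv hx hy hz
    (erefl : l1 = _) (erefl : l2 = _).
  have e3 : (3 * k + 2).+1 = (3 * k.+1)%N by rewrite -addnS.
  apply: (binary_form_power (S := liftable iota x v q k.+1)) => //.
  - by move=> f g; apply: liftableD.
  - by move=> c' f; apply: liftableZ.
  - by rewrite e3.
  - by move=> i' j'; rewrite e3; apply: h1.
have htau : val_eq v 1 (iota (z - z ^+ 2) * (T - iota A)).
  by rewrite -[1]add0r; apply: (val_eqM Hv) => //; apply: (val_eq_const Hv).
have htauX n : val_eq v n%:Z ((iota (z - z ^+ 2) * (T - iota A)) ^+ n).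
  by have := val_eqX n Hv htau; rewrite mulr1.
split=> [im | j ji jm].
  (* Taking [c l1 + d l2] to be the form [tau] itself gives order [3i + 3]; the coefficient
     condition is then the vanishing of [P_(i+1)]. *)
  have Pi' : (A - z ^+ 2) * (A - z ^+ 2) ^+ (3 * i + 2) =
      (A - z) * (A - z) ^+ (3 * i + 2).
    by apply/eqP; rewrite -!exprS -addnS succ -PE Pi.
  have Nq := lt_q i im; rewrite succ in Nq *.
  apply: (liftable_val_eq Hv (lift i _ _ Pi')) => //.
  by rewrite tau -exprSr -addnS succ; apply: htauX.
rewrite succ.
(* Cross-multiplied powers satisfy the coefficient condition for every [j]. *)
apply: (liftable_val_eq Hv (lift j ((A - z) ^+ (3 * j + 2))
  ((A - z ^+ 2) ^+ (3 * j + 2)) _)); [by rewrite mulrC | |].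
  2: by apply: ltnW; rewrite -addnS; apply: lt_q.
rewrite -[(3 * j + 2)%:Z]addr0; apply: (val_eqM Hv) => //.
set c := _ ^+ _; set d := _ ^+ _.
(* The value at [P] of the last linear factor; it is nonzero because [P_(j+1)] does not vanish at
   [alphaP m a]. *)
have r0 : c * (A - z) - d * (A - z ^+ 2) != 0.
  rewrite subr_eq0 -!exprSr eq_sym -addnS succ -PE.
  case: j ji {jm c d} => [_|j ji]; last first.
    by apply: Pk => //; rewrite -addn1.
  (* The [P]-order only speaks of [P_2] onwards; for [j = 0] the difference of cubes is computed
     directly. *)
  rewrite PE -subr_eq0 muln1.
  have -> : (A - z ^+ 2) ^+ 3 - (A - z) ^+ 3 =
      3%:R * (z - z ^+ 2) * A * (A + 1) +
      (z - 1) * (3%:R * A * z - z ^+ 3) * (z ^+ 2 + z + 1) by ring.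
  by rewrite hz mulr0 addr0 !mulf_neq0.
apply: (val_eq_unit Hv r0).
have -> : iota c * l1 + iota d * l2 - iota (c * (A - z) - d * (A - z ^+ 2)) =
    iota (c - d) * (T - iota A) by rewrite /l1 /l2; ring.
by apply: (val_geZ _ Hv); apply: val_eq_ge.
Qed.
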